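(* Let $\mathbf{x}_k\in\mathbb{S}_{n-1}$, let $\alpha>0$, and let $\mathbf{x}_{k+1}=\mathbf{x}_{k+1}(\alpha)$ be defined by $$\mathbf{x}_{k+1}=Q\mathbf{x}_k,\qquad Q=(I+W)^{-1}(I-W),\qquad W=\mathbf{a}\mathbf{b}^{\top}-\mathbf{b}\mathbf{a}^{\top},\qquad \mathbf{a}=\mathbf{x}_k,\quad \mathbf{b}=-\alpha\,\mathbf{g}(\mathbf{x}_k).$$ Then the following assertions hold. (i) The iterative scheme is $$\mathbf{x}_{k+1}(\alpha)=\frac{1-\alpha^2\|\mathbf{g}(\mathbf{x}_k)\|^2}{1+\alpha^2\|\mathbf{g}(\mathbf{x}_k)\|^2}\,\mathbf{x}_k-\frac{2\alpha}{1+\alpha^2\|\mathbf{g}(\mathbf{x}_k)\|^2}\,\mathbf{g}(\mathbf{x}_k).$$ (ii) The progress made by $\mathbf{x}_{k+1}$ is $$\mathbf{g}(\mathbf{x}_k)^{\top}(\mathbf{x}_{k+1}(\alpha)-\mathbf{x}_k)=-\frac{2\alpha\|\mathbf{g}(\mathbf{x}_k)\|^2}{1+\alpha^2\|\mathbf{g}(\mathbf{x}_k)\|^2}.$$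
   Context: Let $m$ be an even positive integer and $n$ a positive integer. For a real symmetric $m$th order $n$-dimensional tensor $\mathcal{A}=(a_{i_1,\ldots,i_m})$ (entries invariant under permutation of indices) and $\mathbf{x}\in\mathbb{R}^n$, let $\mathcal{A}\mathbf{x}^m=\sum_{i_1,\ldots,i_m=1}^n a_{i_1,\ldots,i_m}x_{i_1}\cdots x_{i_m}$, and let $\mathcal{A}\mathbf{x}^{m-1}\in\mathbb{R}^n$ be the vector with $i$th entry $\sum_{i_2,\ldots,i_m=1}^n a_{i,i_2,\ldots,i_m}x_{i_2}\cdots x_{i_m}$. $\mathcal{H}$ is an $m$th order $n$-dimensional Hankel tensor, i.e. $h_{i_1,\ldots,i_m}=v_{i_1+\cdots+i_m-m}$ for a real generating vector $\mathbf{v}=(v_0,\ldots,v_{m(n-1)})^{\top}$. $\mathcal{B}$ is a symmetric $m$th order $n$-dimensional tensor that is positive definite: $\mathcal{B}\mathbf{x}^m>0$ for all $\mathbf{x}\neq 0$. The norm $\|\cdot\|$ is Euclidean and $\mathbb{S}_{n-1}=\{\mathbf{x}\in\mathbb{R}^n:\mathbf{x}^{\top}\mathbf{x}=1\}$. Put $f(\mathbf{x})=\dfrac{\mathcal{H}\mathbf{x}^m}{\mathcal{B}\mathbf{x}^m}$ for $\mathbf{x}\ne0$, whose gradient is $\mathbf{g}(\mathbf{x})=\nabla f(\mathbf{x})=\dfrac{m}{\mathcal{B}\mathbf{x}^m}\Big(\mathcal{H}\mathbf{x}^{m-1}-\dfrac{\mathcal{H}\mathbf{x}^m}{\mathcal{B}\mathbf{x}^m}\mathcal{B}\mathbf{x}^{m-1}\Big)$.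 $I$ is the $n\times n$ identity matrix. *)

(* Defs.v *)
From HB Require Import structures.
From mathcomp Require Import all_boot all_order all_algebra all_fingroup.
From mathcomp Require Import all_classical all_reals all_analysis.
From mathcomp Require Import ring lra.

Set Implicit Arguments.
Unset Strict Implicit.
Unset Printing Implicit Defensive.

Import Order.TTheory GRing.Theory Num.Theory.
Import numFieldNormedType.Exports.

Local Open Scope classical_set_scope.
Local Open Scope ring_scope.

(* Indices are 0-based: they range over 'I_n instead of {1, ..., n}. *)
Definition tensor (R : realType) (m n : nat) := m.-tuple 'I_n -> R.

Definition symmetric_tensor (R : realType) (m n : nat) (A : tensor R m n) :=
  forall s t : m.-tuple 'I_n, perm_eq s t -> A s = A t.

(* A x^m *)
Definition tform (R : realType) (m n : nat) (A : tensor R m n)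
    (x : 'cV[R]_n) : R :=
  \sum_(t : m.-tuple 'I_n) A t * \prod_(j <- t) x j 0.

(* A x^(m-1): the i-th entry sums over the index tuples whose first index is i,
   the first factor being dropped from the product. *)
Definition tvec (R : realType) (m n : nat) (A : tensor R m n)
    (x : 'cV[R]_n) : 'cV[R]_n :=
  \col_i \sum_(t : m.-tuple 'I_n | ohead t == Some i)
     A t * \prod_(j <- behead t) x j 0.

Definition posdef_tensor (R : realType) (m n : nat) (A : tensor R m n) :=
  forall x : 'cV[R]_n, x != 0 -> 0 < tform A x.

(* With 0-based indices the shift by - m in v_(i_1 + ... + i_m - m) is absorbed;
   inord never truncates since the sum is at most m * (n - 1). *)
Definition hankel_tensor (R : realType) (m n : nat)
    (v : 'cV[R]_(m * n.-1).+1) : tensor R m n :=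
  fun t => v (inord (\sum_(i <- t) i)%N) 0.

Definition dotv (R : realType) (n : nat) (u v : 'cV[R]_n) : R :=
  (u^T *m v) 0 0.

(* The norm `|x| that the library puts on 'cV[R]_n is the sup norm. *)
Definition enorm (R : realType) (n : nat) (u : 'cV[R]_n) : R :=
  Num.sqrt (dotv u u).

Definition unit_sphere (R : realType) (n : nat) : set 'cV[R]_n :=
  [set x | dotv x x = 1].

Definition gradient (R : realType) (n : nat) (f : 'cV[R]_n -> R)
    (x : 'cV[R]_n) : 'cV[R]_n :=
  \col_i 'D_(delta_mx i 0) f x.

(* Its value at 0 is a junk 0, since division is total. *)
Definition quotient_form (R : realType) (m n : nat) (A B : tensor R m n)
    (x : 'cV[R]_n) : R := tform A x / tform B x.

Lemma hankel_symmetric (R : realType) (m n : nat) (v : 'cV[R]_(m * n.-1).+1) :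
  symmetric_tensor (hankel_tensor v : tensor R m n).
Proof. by move=> s t st; rewrite /hankel_tensor (perm_big _ st). Qed.

Lemma hankel_index_bound (m n : nat) (t : m.-tuple 'I_n) :
  (\sum_(i <- t) i < (m * n.-1).+1)%N.
Proof.
rewrite ltnS big_tuple (@leq_trans (\sum_(l < m) n.-1)%N) //.
  apply: leq_sum => l _.
  by rewrite -ltnS (leq_trans (ltn_ord (tnth t l))) // leqSpred.
by rewrite sum_nat_const card_ord.
Qed.

Lemma differentiable_tform (R : realType) (m n : nat) (A : tensor R m n) x :
  differentiable (tform A) x.
Proof.
rewrite [tform A](_ : _ = \sum_(k < #|{: m.-tuple 'I_n}|)
   (A (enum_val k) \*: (fun y : 'cV[R]_n => \prod_(j <- enum_val k) y j 0))).
  apply: differentiable_sum => k; apply: differentiableZ.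
  elim: (tval (enum_val k)) => [|j s IH].
    rewrite (_ : (fun _ => _) = cst 1); first exact: differentiable_cst.
    by apply/funext => y; rewrite big_nil.
  rewrite (_ : (fun _ => _) = (fun y : 'cV[R]_n => y j 0 : R) *
     (fun y : 'cV[R]_n => \prod_(j <- s) y j 0)).
    by apply: differentiableM => //; exact: differentiable_coord.
  by apply/funext => y; rewrite big_cons.
apply/funext => y; rewrite fct_sumE /tform (reindex_onto enum_val enum_rank) /=.
  by apply: eq_big => k; rewrite ?enum_valK ?eqxx.
by move=> t _; rewrite enum_rankK.
Qed.

Lemma is_derive_prod_coord (R : realType) (n : nat) (I : eqType) (r : seq I)
    (t : I -> 'I_n) (x v : 'cV[R]_n) : uniq r ->
  is_derive x v (fun y : 'cV[R]_n => \prod_(l <- r) y (t l) 0 : R)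
    (\sum_(l <- r) v (t l) 0 * \prod_(k <- r | k != l) x (t k) 0).
Proof.
elim: r => [_|l r IH /= /andP[lr ur]].
  rewrite big_nil (_ : (fun _ => _) = cst 1); first exact: is_derive_cst.
  by apply/funext => y; rewrite big_nil.
have dc : is_derive x v (fun y : 'cV[R]_n => y (t l) 0 : R) (v (t l) 0).
  apply: DeriveDef; first exact/diff_derivable/differentiable_coord.
  rewrite /derive; apply: cvg_lim => //.
  apply: cvg_near_cst; near=> h => /=.
  rewrite !mxE addrK /GRing.scale /= mulrA mulVf ?mul1r//.
  by near: h; exact: nbhs_dnbhs_neq.
rewrite (_ : (fun _ => _) = (fun y : 'cV[R]_n => y (t l) 0 : R) *
     (fun y : 'cV[R]_n => \prod_(j <- r) y (t j) 0)); last first.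
  by apply/funext => y; rewrite big_cons.
have h := IH ur.
apply: is_derive_eq; rewrite !big_cons eqxx /= addrC; congr (_ + _).
  rewrite /GRing.scale /= mulrC; congr (_ * _).
  rewrite big_seq_cond [RHS]big_seq_cond; apply: eq_bigl => k.
  by rewrite andbT; case: eqP => [->|]; rewrite ?(negPf lr) ?andbT.
rewrite /GRing.scale /= big_distrr /= big_seq_cond [RHS]big_seq_cond.
apply: eq_bigr => k /andP[kr _].
rewrite big_cons (_ : l != k); first by rewrite mulrCA.
by apply: contraNneq lr => ->.
Unshelve. all: by end_near. Qed.

Lemma gradient_tform (R : realType) (m n : nat) (A : tensor R m n) x :
  symmetric_tensor A -> gradient (tform A) x = m%:R *: tvec A x.
Proof.
move=> sA; apply/matrixP => i j; rewrite !mxE {j}.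
pose P k (t : m.-tuple 'I_n) :=
  (tnth t k == i)%:R * \prod_(l < m | l != k) x (tnth t l) 0.
have dA : is_derive x (delta_mx i 0) (tform A)
    (\sum_(t : m.-tuple 'I_n) A t * \sum_(k < m) P k t).
  rewrite [tform A](_ : _ = \sum_(k < #|{: m.-tuple 'I_n}|)
     (A (enum_val k) \*:
       (fun y : 'cV[R]_n => \prod_(l < m) y (tnth (enum_val k) l) 0))).
    have -> : \sum_(t : m.-tuple 'I_n) A t * \sum_(k < m) P k t =
        \sum_(k < #|{: m.-tuple 'I_n}|)
          A (enum_val k) * \sum_(l < m) P l (enum_val k).
      rewrite (reindex_onto enum_val enum_rank) /=.
        by apply: eq_bigl => k; rewrite enum_valK eqxx.
      by move=> t _; rewrite enum_rankK.
    apply: is_derive_sum => k.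
    apply: is_deriveZ.
    rewrite /P; under eq_bigr => l _.
      rewrite (_ : (_ == i)%:R =
        delta_mx i 0 (tnth (enum_val k) l) (0 : 'I_1) :> R); last first.
        by rewrite mxE eqxx andbT.
    over.
    by apply: is_derive_prod_coord; exact: index_enum_uniq.
  apply/funext => y; rewrite fct_sumE /tform.
  rewrite (reindex_onto enum_val enum_rank) /=.
    apply: eq_big => k; rewrite ?enum_valK ?eqxx// => _.
    by rewrite big_tuple.
  by move=> t _; rewrite enum_rankK.
rewrite (@derive_val _ _ _ _ _ _ _ dA).
case: m A sA @P {dA} => [|m] A sA P.
  by rewrite mul0r big1 // => t _; rewrite big_ord0 mulr0.
under eq_bigr do rewrite big_distrr /=.
rewrite exchange_big /=.
have e0 : \sum_t A t * P ord0 t =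
    \sum_(t : m.+1.-tuple 'I_n | ohead t == Some i) A t * \prod_(j <- behead t) x j 0.
  rewrite [RHS]big_mkcond /=; apply: eq_bigr => t _.
  rewrite /P; case/tupleP: t => h u /=; rewrite tnth0 (inj_eq Some_inj).
  case: (h =P i) => _; last by rewrite mul0r mulr0.
  rewrite mul1r big_mkcond big_ord_recl /= mul1r big_tuple; congr (_ * _).
  by apply: eq_bigr => l _; rewrite tnthS.
rewrite -e0.
rewrite (_ : m.+1%:R * _ = \sum_(k < m.+1) \sum_t A t * P ord0 t); last first.
  by rewrite sumr_const card_ord mulr_natl.
apply: eq_bigr => k _.
pose s := tperm ord0 k.
pose F (t : m.+1.-tuple 'I_n) := [tuple tnth t (s l) | l < m.+1].
have FK : involutive F.
  by move=> t; apply: eq_from_tnth => l; rewrite !tnth_mktuple tpermK.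
rewrite (reindex_inj (inv_inj FK)) /=; apply: eq_bigr => t _.
congr (_ * _).
  by apply: sA; apply/tuple_permP; exists s.
rewrite /P tnth_mktuple /s tpermR; congr (_ * _).
rewrite (reindex_inj (@perm_inj _ s)) /=; apply: eq_big => l.
  by rewrite -{1}(tpermL ord0 k) (inj_eq perm_inj).
by move=> _; rewrite tnth_mktuple tpermK.
Qed.

(* Away from 0 the directional derivatives in [gradient] thus exist. *)
Lemma differentiable_quotient_form (R : realType) (m n : nat)
    (A B : tensor R m n) x : posdef_tensor B -> x != 0 ->
  differentiable (quotient_form A B) x.
Proof.
move=> pB x0; have Bx : tform B x != 0 by rewrite gt_eqF ?pB.
rewrite (_ : quotient_form A B = tform A * (fun y => (tform B y)^-1)) //.
apply: differentiableM; first exact: differentiable_tform.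
by apply: differentiableV => //; exact: differentiable_tform.
Qed.

Lemma gradient_quotient_form (R : realType) (m n : nat)
    (A B : tensor R m n) x :
  symmetric_tensor A -> symmetric_tensor B -> posdef_tensor B -> x != 0 ->
  gradient (quotient_form A B) x =
  (m%:R / tform B x) *: (tvec A x - (tform A x / tform B x) *: tvec B x).
Proof.
move=> sA sB pB x0; have Bx : tform B x != 0 by rewrite gt_eqF ?pB.
apply/matrixP => i j; rewrite !mxE {j}.
have dE (C : tensor R m n) : symmetric_tensor C ->
    'D_(delta_mx i 0) (tform C) x = m%:R * tvec C x i 0.
  move=> sC; rewrite mxE.
  by have /matrixP/(_ i 0) := gradient_tform x sC; rewrite !mxE.
have dd (C : tensor R m n) : derivable (tform C) x (delta_mx i 0).
  exact/diff_derivable/differentiable_tform.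
rewrite (_ : quotient_form A B = tform A * (fun y => (tform B y)^-1)) //.
rewrite deriveM //; last exact: derivableV.
rewrite deriveV // !dE // !mxE /GRing.scale /=.
by field.
Qed.

(* invmx (1%:M + W) is a genuine inverse in the Cayley transform of a skew W. *)
Lemma skew_cayley_unit (R : realType) (n : nat) (W : 'M[R]_n) :
  W^T = - W -> 1%:M + W \in unitmx.
Proof.
move=> sW; rewrite -row_free_unit -kermx_eq0.
apply/rowV0P => u /sub_kermxP; rewrite mulmxDr mulmx1 => uW.
have c0 : (u *m W *m u^T) 0 0 = 0.
  have : (u *m W *m u^T)^T 0 0 = (u *m W *m u^T) 0 0 by rewrite mxE.
  rewrite !trmx_mul trmxK sW mulNmx mulmxN mulmxA mxE.
  set c := _ 0 0; lra.
have : (u *m u^T) 0 0 = 0.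
  have : ((u + u *m W) *m u^T) 0 0 = 0 by rewrite uW mul0mx mxE.
  by rewrite mulmxDl mxE c0 addr0.
rewrite mxE => /eqP; rewrite psumr_eq0; last first.
  by move=> j _; rewrite mxE -expr2 sqr_ge0.
move=> /allP u0; apply/rowP => j; rewrite mxE.
have := u0 j (mem_index_enum _).
by rewrite mxE /= mulf_eq0 orbb => /eqP.
Qed.

(* Main.v *)
(* The quotient f is homogeneous of degree 0, so Euler's identity makes its
   gradient orthogonal to x.  With x a unit vector orthogonal to b, the rank two
   matrix W acts on the plane spanned by x and b by W x = - b and
   W b = |b|^2 x, so (I + W) y = (I - W) x can be solved in that plane; (ii)
   is then the dot product of (i) with the gradient. *)
Require Import Defs.
From mathcomp Require Import all_boot all_order all_algebra.
From mathcomp Require Import all_classical all_reals all_analysis.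
From mathcomp Require Import ring.

Import Order.TTheory GRing.Theory Num.Theory.
Local Open Scope ring_scope.

Lemma dotvE (R : realType) (n : nat) (u w : 'cV[R]_n) :
  dotv u w = \sum_i u i 0 * w i 0.
Proof. by rewrite /dotv mxE; apply: eq_bigr => i _; rewrite mxE. Qed.

Lemma dotvC (R : realType) (n : nat) (u w : 'cV[R]_n) : dotv u w = dotv w u.
Proof. by rewrite !dotvE; apply: eq_bigr => i _; rewrite mulrC. Qed.

Lemma dotvDr (R : realType) (n : nat) (u w z : 'cV[R]_n) :
  dotv u (w + z) = dotv u w + dotv u z.
Proof. by rewrite /dotv mulmxDr mxE. Qed.

Lemma dotvZr (R : realType) (n : nat) (c : R) (u w : 'cV[R]_n) :
  dotv u (c *: w) = c * dotv u w.
Proof. by rewrite /dotv -scalemxAr mxE. Qed.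

Lemma dotvNr (R : realType) (n : nat) (u w : 'cV[R]_n) :
  dotv u (- w) = - dotv u w.
Proof. by rewrite /dotv mulmxN mxE. Qed.

Lemma dotv_ge0 (R : realType) (n : nat) (u : 'cV[R]_n) : 0 <= dotv u u.
Proof. by rewrite dotvE sumr_ge0 // => i _; rewrite -expr2 sqr_ge0. Qed.

Lemma enorm_sqr (R : realType) (n : nat) (u : 'cV[R]_n) :
  enorm u ^+ 2 = dotv u u.
Proof. by rewrite sqr_sqrtr // dotv_ge0. Qed.

(** Lets each half of the skew matrix [W] act on a vector through a single scalar product. *)
Lemma mulmx_dotv (R : realType) (n : nat) (u w z : 'cV[R]_n) :
  u *m w^T *m z = dotv w z *: u.
Proof. by rewrite -mulmxA [w^T *m z]mx11_scalar mul_mx_scalar. Qed.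

(** Euler's identity in algebraic form: the factor [x i 0] restores the one dropped by [behead]. A
    positive order ensures that every index tuple has a head. *)
Lemma dotv_tvec (R : realType) (m n : nat) (A : tensor R m n) (x : 'cV[R]_n) :
  (0 < m)%N -> dotv x (tvec A x) = tform A x.
Proof.
case: m A => // m A _; rewrite dotvE /tform.
under eq_bigr do rewrite mxE big_distrr big_mkcond /=.
rewrite exchange_big /=; apply: eq_bigr => t _.
(* After the exchange of sums, a tuple with head [h] contributes only at [i = h]. *)
case/tupleP: t => h u /=; rewrite (bigD1 h) //= eqxx [X in _ + X]big1 => [|i ih].
  by rewrite addr0 big_cons mulrCA.
by rewrite (inj_eq Some_inj) eq_sym (negPf ih).
Qed.

(** Pairing the explicit gradient with [x] leaves a multiple of [tform A x - (tform A x / tform B x)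
    * tform B x], which cancels. *)
Lemma dotv_gradient_quotient_form (R : realType) (m n : nat)
    (A B : tensor R m n) (x : 'cV[R]_n) :
  (0 < m)%N -> symmetric_tensor A -> symmetric_tensor B -> posdef_tensor B ->
  x != 0 -> dotv x (gradient (quotient_form A B) x) = 0.
Proof.
move=> m0 sA sB pB x0; rewrite gradient_quotient_form // dotvZr dotvDr dotvNr.
by rewrite dotvZr !dotv_tvec // divfK ?subrr ?mulr0 // gt_eqF ?pB.
Qed.

Lemma cayley_rank2 (R : realType) (n : nat) (x b : 'cV[R]_n) :
  dotv x x = 1 -> dotv x b = 0 ->
  let W := x *m b^T - b *m x^T in
  invmx (1%:M + W) *m (1%:M - W) *m x =
  ((1 - dotv b b) / (1 + dotv b b)) *: x + (2 / (1 + dotv b b)) *: b.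
Proof.
move=> xx xb W.
have WU : 1%:M + W \in unitmx.
  by apply: skew_cayley_unit; rewrite linearB /= !trmx_mul !trmxK opprB.
have Wx : W *m x = - b.
  by rewrite mulmxBl !mulmx_dotv xx dotvC xb scale0r scale1r sub0r.
have Wb : W *m b = dotv b b *: x.
  by rewrite mulmxBl !mulmx_dotv xb scale0r subr0.
have b1 : 1 + dotv b b != 0 by rewrite gt_eqF // ltr_pwDl ?dotv_ge0.
(* The inverse is never computed: multiplying by [1%:M + W] reduces the claim to [Wx] and [Wb], and
   both sides become [x + b]. *)
clearbody W; rewrite -mulmxA; apply: (can_inj (mulKmx WU)); rewrite mulKVmx //.
rewrite mulmxBl mulmxDl !mul1mx mulmxDr -!scalemxAr Wx Wb.
move: (dotv b b) b1 => c c1; apply/colP => i; rewrite !mxE.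
by move: (x i 0) (b i 0) => s t; field.
Qed.

Theorem theorem1 (R : realType) (m n : nat)
    (m_gt0 : (0 < m)%N) (m_even : ~~ odd m) (n_gt0 : (0 < n)%N)
    (v : 'cV[R]_(m * n.-1).+1) (B : tensor R m n)
    (B_sym : symmetric_tensor B) (B_posdef : posdef_tensor B)
    (x : 'cV[R]_n) (x_sphere : unit_sphere x)
    (alpha : R) (alpha_gt0 : 0 < alpha) :
  let f := quotient_form (hankel_tensor v) B in
  let g := gradient f x in
  let a := x in
  let b := - alpha *: g in
  let W := a *m b^T - b *m a^T in
  let Q := invmx (1%:M + W) *m (1%:M - W) in
  let x_next := Q *m x in
  x_next = ((1 - alpha ^+ 2 * enorm g ^+ 2) / (1 + alpha ^+ 2 * enorm g ^+ 2)) *: x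
           - (2 * alpha / (1 + alpha ^+ 2 * enorm g ^+ 2)) *: g
  /\
  dotv g (x_next - x) =
    - (2 * alpha * enorm g ^+ 2 / (1 + alpha ^+ 2 * enorm g ^+ 2)).
Proof.
move=> f g a b W Q x_next.
have xx : dotv x x = 1 := x_sphere.
have x0 : x != 0.
  apply/eqP => x0; move: xx; rewrite x0 /dotv mulmx0 mxE => /esym/eqP.
  by rewrite oner_eq0.
have xg : dotv x g = 0.
  by apply: dotv_gradient_quotient_form => //; exact: hankel_symmetric.
have xb : dotv x b = 0 by rewrite dotvZr xg mulr0.
(* The sign in [b] disappears here, but it makes the [g] term of the scheme negative. *)
have bb : dotv b b = alpha ^+ 2 * dotv g g.
  by rewrite dotvZr dotvC dotvZr mulrA mulrNN -expr2.
have scheme : x_next =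
    ((1 - alpha ^+ 2 * enorm g ^+ 2) / (1 + alpha ^+ 2 * enorm g ^+ 2)) *: x
    - (2 * alpha / (1 + alpha ^+ 2 * enorm g ^+ 2)) *: g.
  rewrite /x_next /Q /W /a cayley_rank2 // bb enorm_sqr; congr (_ + _).
  by rewrite /b scalerA mulrN scaleNr mulrAC.
split=> //.
(* By orthogonality both [x] terms vanish, so only the [g] term of the scheme contributes. *)
rewrite scheme !dotvDr !dotvNr !dotvZr [dotv g x]dotvC xg enorm_sqr.
by rewrite mulr0 add0r subr0 mulrAC.
Qed.
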